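(* Let $K$ be a finite field with $q$ elements, let $s\geq 1$, let $w_1,\dots,w_s$ be positive integers with $\gcd(w_1,\dots,w_s)=1$, and let $d\geq 0$. Then the length of the weighted projective Reed--Muller code $C_{\mathbb{T}}(d)$ of order $d$ over the weighted projective torus $\mathbb{T}(w_1,\dots,w_s)$ is $(q-1)^{s-1}$.
   Context: The weighted projective space $\mathbb{P}(w_1,\dots,w_s)$ is the quotient $(K^s\setminus 0)/K^*$, where $\lambda\in K^*$ acts by $\lambda(x_1,\dots,x_s)=(\lambda^{w_1}x_1,\dots,\lambda^{w_s}x_s)$. The weighted projective torus is $\mathbb{T}(w_1,\dots,w_s)=\{(x_1,\dots,x_s)\in\mathbb{P}(w_1,\dots,w_s): x_1\cdots x_s\neq 0\}$. The polynomial ring $K[t_1,\dots,t_s]$ is graded by $\deg(t_i)=w_i$. For $X\subset\mathbb{P}(w_1,\dots,w_s)$ with $m=|X|$, fix systems of homogeneous coordinates $\underline{x}_1,\dots,\underline{x}_m\in K^s$ of the points of $X$. For $d\geq 0$ let $\operatorname{ev}_d\colon K[t_1,\dots,t_s]_d\to K^m$ be $f\mapsto(f(\underline{x}_1),\dots,f(\underline{x}_m))$. The image of $\operatorname{ev}_d$, denoted $C_X(d)$, is the weighted projective Reed--Muller code over $X$ of order $d$; $C_{\mathbb{T}}(d)$ denotes the case $X=\mathbb{T}(w_1,\dots,w_s)$. The length of a code $C\subset K^m$ is $m$, the dimension of the ambient vector space; thus the length of $C_X(d)$ is $|X|$. *)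

(* Defs.v *)
From HB Require Import structures.
From mathcomp Require Import all_boot all_order all_algebra all_fingroup.
From mathcomp Require Export mpoly.

Set Implicit Arguments.
Unset Strict Implicit.
Unset Printing Implicit Defensive.

Import GRing.Theory.
Local Open Scope ring_scope.

Section WeightedProjectiveSpace.
Context (K : finFieldType) (s : nat) (w : 'I_s -> nat).

Definition wscale (x : 'rV[K]_s) (u : {unit K}) : 'rV[K]_s :=
  \row_i (FinRing.uval u ^+ w i * x 0 i).

Lemma wscale1 : wscale^~ 1%g =1 id.
Proof. by move=> x; apply/rowP => i; rewrite !mxE expr1n mul1r. Qed.

Lemma wscaleM x : act_morph wscale x.
Proof.
by move=> u v; apply/rowP => i; rewrite !mxE /= exprMn mulrCA mulrA.
Qed.

Definition wscale_action : {action {unit K} &-> 'rV[K]_s} :=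
  TotalAction wscale1 wscaleM.

Definition wpoint (x : 'rV[K]_s) : {set 'rV[K]_s} :=
  orbit wscale_action [set: {unit K}] x.

Definition wprojspace : {set {set 'rV[K]_s}} :=
  [set wpoint x | x : 'rV[K]_s & x != 0].

(* The condition x != 0 follows from the other one except when s = 0. *)
Definition wprojtorus : {set {set 'rV[K]_s}} :=
  [set wpoint x | x : 'rV[K]_s & (x != 0) && (\prod_i x 0 i != 0)].

Definition homog_coords (X : {set {set 'rV[K]_s}}) (x : 'I_#|X| -> 'rV[K]_s) :=
  injective (fun i => wpoint (x i)) /\ [set wpoint (x i) | i : 'I_#|X|] = X.

Lemma homog_coords_exist (X : {set {set 'rV[K]_s}}) :
  X \subset wprojspace -> exists x, @homog_coords X x.
Proof.
move=> /subsetP sX.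
have ex (i : 'I_#|X|) : exists x, wpoint x == enum_val i.
  by have /sX /imsetP[x _ ->] := enum_valP i; exists x.
exists (fun i => xchoose (ex i)).
have xE i : wpoint (xchoose (ex i)) = enum_val i by apply/eqP/(xchooseP (ex i)).
split=> [i j|]; first by rewrite !xE; apply: enum_val_inj.
apply/setP => p; apply/imsetP/idP => [[i _ ->]|Xp].
  by rewrite xE; apply: enum_valP.
by exists (enum_rank_in Xp p); rewrite // xE enum_rankK_in.
Qed.

End WeightedProjectiveSpace.

Section WeightedDegree.
Context (s : nat) (w : 'I_s -> nat).

Definition wdeg (m : 'X_{1..s}) : nat := (\sum_i m i * w i)%N.

Lemma wdeg0 : wdeg 0%MM = 0%N.
Proof. by rewrite /wdeg big1 // => i _; rewrite mnm0E. Qed.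

Lemma wdegD : {morph wdeg : m1 m2 / (m1 + m2)%MM >-> (m1 + m2)%N}.
Proof.
move=> m1 m2; rewrite /wdeg -big_split /=.
by apply: eq_bigr => i _; rewrite mnmDE mulnDl.
Qed.

HB.instance Definition _ := isMeasure.Build s wdeg wdeg0 wdegD.

Lemma leq_mdeg_wdeg m : (forall i, 0 < w i)%N -> (mdeg m <= wdeg m)%N.
Proof. by move=> w0; rewrite mdegE leq_sum // => i _; rewrite leq_pmulr. Qed.

End WeightedDegree.

Section WeightedHomogeneous.
Context (K : fieldType) (s : nat) (w : 'I_s -> nat).

(* K[t_1, ..., t_s]_d for deg t_i = w i. Positivity of the weights is a
   parameter because it makes this space finite dimensional. *)
Record whomog (w_gt0 : forall i, (0 < w i)%N) (d : nat) := WHomog {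
  mpoly_of_whomog :> {mpoly K[s]};
  _ : mpoly_of_whomog \is d.-homog for (wdeg w) }.

Context (w_gt0 : forall i, (0 < w i)%N) (d : nat).
Local Notation Kt_d := (whomog w_gt0 d).

HB.instance Definition _ := [isSub for @mpoly_of_whomog w_gt0 d].
HB.instance Definition _ := [Choice of Kt_d by <:].
HB.instance Definition _ := [SubChoice_isSubLmodule of Kt_d by <:].

Local Notation monom := {m : 'X_{1..s < d.+1} | wdeg w m == d}.

Lemma whomog_vecaxiom : Vector.axiom #|{: monom}| Kt_d.
Proof.
pose mn (i : 'I_#|{: monom}|) : 'X_{1..s} := val (val (enum_val i)).
have mn_inj : injective mn by move=> i j /val_inj/val_inj/enum_val_inj.
have mn_onto m : wdeg w m == d -> exists i, mn i = m.
  move=> wm; have bm : (mdeg m < d.+1)%N.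
    by rewrite ltnS -(eqP wm) leq_mdeg_wdeg.
  exists (enum_rank (exist (fun m : 'X_{1..s < d.+1} => wdeg w m == d)
                           (BMultinom bm) wm)).
  by rewrite /mn enum_rankK.
pose g (r : 'rV[K]_#|{: monom}|) : {mpoly K[s]} := \sum_i r 0 i *: 'X_[mn i].
have gE r i : (g r)@_(mn i) = r 0 i.
  rewrite raddf_sum /= (bigD1 i) //= mcoeffZ mcoeffX eqxx mulr1.
  rewrite big1 ?addr0 // => j ji.
  by rewrite mcoeffZ mcoeffX (inj_eq mn_inj) (negPf ji) mulr0.
have gP r : g r \is d.-homog for (wdeg w).
  apply: rpred_sum => i _; apply: rpredZ; rewrite dhomogX /=.
  exact: (valP (enum_val i)).
exists (fun p : Kt_d => \row_i (val p)@_(mn i)).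
  by move=> c p q; apply/rowP => i; rewrite !mxE /= mcoeffD mcoeffZ.
exists (fun r => WHomog w_gt0 (gP r)) => [p|r]; last first.
  by apply/rowP => i; rewrite mxE /= gE.
apply/val_inj/mpolyP => m /=.
have [/mn_onto[i <-]|ndm] := boolP (wdeg w m == d); first by rewrite gE mxE.
by rewrite (dhomog_nemf_coeff (gP _)) // (dhomog_nemf_coeff (valP p)).
Qed.

HB.instance Definition _ := Lmodule_hasFinDim.Build K Kt_d whomog_vecaxiom.

Definition wev m (x : 'I_m -> 'rV[K]_s) (f : Kt_d) : 'rV[K]_m :=
  \row_i (val f).@[x i 0].

Lemma wev_is_linear m (x : 'I_m -> 'rV[K]_s) : linear (wev x).
Proof. by move=> c f g; apply/rowP => i; rewrite !mxE /= mevalD mevalZ. Qed.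

HB.instance Definition _ m (x : 'I_m -> 'rV[K]_s) :=
  GRing.isLinear.Build K Kt_d 'rV[K]_m _ (wev x) (wev_is_linear x).

Definition wprm_code m (x : 'I_m -> 'rV[K]_s) : {vspace 'rV[K]_m} :=
  limg (linfun (wev x)).

End WeightedHomogeneous.

Definition code_length (K : fieldType) (V : vectType K) (C : {vspace V}) : nat :=
  \dim {: V}.

Lemma code_length_rV (K : fieldType) m (C : {vspace 'rV[K]_m}) :
  code_length C = m.
Proof. by rewrite /code_length dimvf /dim /= mul1n. Qed.

(* Main.v *)
(* The action of K^* on the vectors with nonzero entries is free: if u fixes such a
   vector then u^(w_i) = 1 for all i, so the order of u divides
   gcd(w_1, ..., w_s) = 1. Hence the (q-1)^s such vectors split into orbits of
   size q-1, and these orbits are the points of the torus. *)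
Require Import Defs.
From mathcomp Require Import all_boot all_order all_algebra all_fingroup.
From mathcomp Require Import cyclic finfield.

Import GRing.Theory.
Local Open Scope ring_scope.

(** The order of [u] divides every [w i], hence their gcd; the neutral value 0 of the iterated gcd
    is harmless, since every order divides 0. *)
Lemma expg_gcd_eq1 (gT : finGroupType) (I : finType) (w : I -> nat) (u : gT) :
  (forall i, u ^+ w i = 1)%g -> (u ^+ (\big[gcdn/0%N]_i w i) = 1)%g.
Proof.
move=> uw1; apply/eqP; rewrite -order_dvdn.
elim/big_ind: _ => // [m n um un|i _]; first by rewrite dvdn_gcd um.
by rewrite order_dvdn uw1 eqxx.
Qed.

Section TorusCardinality.
Context (K : finFieldType) (s : nat) (w : 'I_s -> nat).

Definition nonzero_entries : {set 'rV[K]_s} :=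
  [set x : 'rV[K]_s | \prod_i x 0 i != 0].

Lemma nonzero_entriesP (x : 'rV[K]_s) :
  reflect (forall i, x 0 i != 0) (x \in nonzero_entries).
Proof.
rewrite inE; apply: (iffP (prodf_neq0 _ _)) => x0 i; first exact: x0.
by move=> _; apply: x0.
Qed.

Lemma card_nonzero_entries : #|nonzero_entries| = (#|K|.-1 ^ s)%N.
Proof.
pose row (f : {ffun 'I_s -> K}) : 'rV[K]_s := \row_i f i.
have row_inj : injective row.
  by move=> f g /rowP fg; apply/ffunP => i; have := fg i; rewrite !mxE.
(* Via [row], these vectors correspond to the functions from ['I_s] to the complement of 0 in
   [K]. *)
rewrite -(cardC1 (0 : K)) -[s in RHS]card_ord -card_ffun_on.
rewrite -(card_imset _ row_inj); apply: eq_card => x.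
apply/nonzero_entriesP/imsetP => [x0|[f /ffun_onP f0 ->] i]; last first.
  by rewrite mxE; apply: f0.
exists [ffun i => x 0 i]; last by apply/rowP => i; rewrite mxE ffunE.
by apply/ffun_onP => i; rewrite ffunE; apply: x0.
Qed.

Lemma acts_nonzero_entries :
  [acts [set: {unit K}], on nonzero_entries | wscale_action K w].
Proof.
apply/actsP => u _ x; apply/nonzero_entriesP/nonzero_entriesP => x0 i.
  by have := x0 i; rewrite /= mxE mulf_eq0 negb_or => /andP[].
by rewrite /= mxE mulf_neq0 // expf_neq0 // -unitfE (valP u).
Qed.

Lemma card_wpoint (w_gcd : \big[gcdn/0%N]_i w i = 1%N) (x : 'rV[K]_s) :
  x \in nonzero_entries -> #|wpoint w x| = #|K|.-1.
Proof.
move=> /nonzero_entriesP x0; rewrite -card_finField_unit card_in_imset //.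
(* Injectivity of the orbit map: [u = v] is restated as triviality of the quotient of [u] by [v],
   raised to the power 1, which is the gcd of the weights. *)
move=> u v _ _ /rowP uv; apply/eqP; rewrite eq_mulgV1 -[X in X == _]expg1.
rewrite -w_gcd; apply/eqP/expg_gcd_eq1 => i.
have := uv i; rewrite !mxE => /(mulIf (x0 i)) uvi.
have -> : (u * v^-1 = v^-1 * u)%g by apply: val_inj; rewrite /= mulrC.
apply: val_inj; rewrite FinRing.val_unitX /= exprMn uvi exprVn mulVr //.
by rewrite unitrX // (valP v).
Qed.

(** With at least one coordinate, the zero vector has product 0; for [s = 0] the empty product would
    be 1. *)
Lemma wprojtorusE :
  (0 < s)%N -> wprojtorus K w = [set wpoint w x | x in nonzero_entries].
Proof.
move=> s_gt0.
suff <- : [set x : 'rV[K]_s | (x != 0) && (\prod_i x 0 i != 0)]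
          = nonzero_entries by [].
apply/setP => x; rewrite !inE andb_idl // => x0; apply: contraNneq x0 => ->.
by rewrite (bigD1 (Ordinal s_gt0)) //= mxE mul0r.
Qed.

Lemma card_wprojtorus :
  (0 < s)%N -> \big[gcdn/0%N]_i w i = 1%N ->
  #|wprojtorus K w| = (#|K|.-1 ^ s.-1)%N.
Proof.
move=> s_gt0 w_gcd; have K1_gt0 : (0 < #|K|.-1)%N.
  by rewrite -card_finField_unit cardG_gt0.
(* Multiplying both sides by the orbit size q-1 avoids a division: the right side becomes the number
   of vectors with nonzero entries. *)
apply/eqP; rewrite -(eqn_pmul2r K1_gt0) -expnSr prednK //.
rewrite -card_nonzero_entries wprojtorusE //; apply/eqP/esym.
apply: card_uniform_partition (orbit_partition acts_nonzero_entries).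
by move=> _ /imsetP[x x0 ->]; apply: card_wpoint.
Qed.

End TorusCardinality.

Local Close Scope ring_scope.

Theorem proposition3p5 (K : finFieldType) (q : nat) (hq : #|K| = q)
    (s : nat) (hs : (1 <= s)%N)
    (w : 'I_s -> nat) (w_gt0 : forall i : 'I_s, (0 < w i)%N)
    (w_gcd : \big[gcdn/0%N]_(i < s) w i = 1%N)
    (d : nat)
    (x : 'I_#|wprojtorus K w| -> 'rV[K]_s)
    (hx : @homog_coords K s w (wprojtorus K w) x) :
  code_length (wprm_code w_gt0 d x) = ((q - 1) ^ (s - 1))%N.
Proof. by rewrite code_length_rV card_wprojtorus // hq !subn1. Qed.
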